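(* Let $0\le r\le C_{\min}$, where $C_{\min}=\min_{1\le i\le s}\mathrm{mincut}(\sigma_i,\rho)$, and let $\mathcal W^*_r=\{W\in\mathcal W_r: W=\widehat W,\ |W|=r\}$. Then for every integer $R$ with $r\le R\le C_{\min}$, if the field size satisfies $q>s\cdot|\mathcal W^*_r|$, there exists an $\mathbb F_q$-valued admissible $(R-r,1)$ linear secure network code for $(\mathcal N,f,r)$, where $f$ is the algebraic sum over $\mathbb F_q$.
   Context: Network model: $\mathcal G=(\mathcal V,\mathcal E)$ is a finite directed acyclic graph (multiple edges allowed); $\mathcal E_{\rm in}(u)$ are the input edges of node $u$. $S=\{\sigma_1,\dots,\sigma_s\}$ is the set of source nodes (exactly the nodes without input edges), $\rho\notin S$ the sink (no output edges), every node other than $\rho$ has a directed path to $\rho$; $\mathcal N=(\mathcal G,S,\rho)$. For a node $\sigma$ and edge $e$, $\sigma\to e$ means there is a directed path from $\sigma$ whose last edge is $e$. $\mathrm{mincut}(u,v)$ is the minimum size of an edge set whose deletion leaves no path from node $u$ to node $v$. For $W\subseteq\mathcal E$, $D_W=\{\sigma\in S:\exists e\in W,\ \sigma\to e\}$. $\mathcal W_r=\{W\subseteq\mathcal E:|W|\le r\}$. Cuts separating edge sets: an edge set $C$ separates an edge set $X$ from a node set $U$ if every path from a node of $U$ to an edge of $X$ uses an edge of $C$ (formally via subdividing each $e\in X$ by a new node into two edges identified with $e$); a minimum cut is one of minimum size; a minimum cut separating $X$ from $U$ is primary if it separates from $U$ every minimum cut separating $X$ from $U$ (it exists and is unique). $\widehat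 W$ is the primary minimum cut separating $W$ from $D_W$. Secure model and linear codes: $q$ a prime power, $f(m_1,\dots,m_s)=\sum_im_i$ over $\mathbb F_q$, each edge carries one symbol of $\mathbb F_q$ per use. An $(\ell,n)$ linear secure network code over $\mathbb F_q$: source $\sigma_i$ holds $\mathbf M_i\in\mathbb F_q^\ell$ with i.i.d. uniform entries and a key $\mathbf K_i$ uniform on $\mathbb F_q^{r_i}$ ($r_i\ge0$ an integer), all mutually independent; the message on an edge $e$ with $\mathrm{tail}(e)=\sigma_i$ is $(\mathbf m_i\ \mathbf k_i)A_{i,e}$ for an $(\ell+r_i)\times n$ matrix $A_{i,e}$ over $\mathbb F_q$, and on any other edge $e$ it is $\sum_{d\in\mathcal E_{\rm in}(\mathrm{tail}(e))}\mathbf y_dA_{d,e}$ with $n\times n$ matrices $A_{d,e}$; a decoding function (arbitrary) maps the messages on $\mathcal E_{\rm in}(\rho)$ to $\mathbb F_q^\ell$. It is admissible if the decoder outputs $\sum_i\mathbf m_i$ for all messages and keys, and $I(\mathbf Y_W;\mathbf M_S)=0$ for every $W\in\mathcal W_r$, where $\mathbf Y_W$ are the (random) messages on $W$ and $\mathbf M_S=(\mathbf M_1,\dots,\mathbf M_s)$. *)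

(* Defs.v *)
From HB Require Import structures.
From mathcomp Require Import all_boot all_order all_algebra.
From mathcomp Require Import Rstruct.
From Stdlib Require Rpower.

Set Implicit Arguments.
Unset Strict Implicit.
Unset Printing Implicit Defensive.

Import Order.TTheory GRing.Theory Num.Theory.

(* I(X;Y) = sum_{a,b} p(a,b) ln (p(a,b) / (p(a) p(b))), with 0 ln 0 = 0. *)
Section MutInfo.
Local Open Scope ring_scope.
Variables (Omega A B : finType) (X : Omega -> A) (Y : Omega -> B).

Definition prob (P : pred Omega) : Rdefinitions.R := (#|[set w | P w]|%:R / #|Omega|%:R)%R.

Definition mutinfo : Rdefinitions.R :=
  \sum_(a : A) \sum_(b : B)
    let pab := prob (fun w => (X w == a) && (Y w == b)) in
    let pa := prob (fun w => X w == a) in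
    let pb := prob (fun w => Y w == b) in
    (if pab == 0 then 0 else pab * Rpower.ln (pab / (pa * pb)))%R.
End MutInfo.

Section Network.
Variables (V E : finType) (tail head : E -> V) (s : nat)
          (sigma : 'I_s -> V) (rho : V).

Definition erel : rel E := fun e d => head e == tail d.

Definition erel_avoid (C : {set E}) : rel E :=
  fun e d => [&& e \notin C, d \notin C & erel e d].

Definition reach_avoid (C : {set E}) (u : V) (e : E) : bool :=
  [exists d, [&& tail d == u, d \notin C, e \notin C & connect (erel_avoid C) d e]].

Definition reach (u : V) (e : E) : bool := reach_avoid set0 u e.

Definition npath_avoid (C : {set E}) (u v : V) : bool :=
  [exists e, exists d, [&& tail e == u, head d == v, e \notin C, d \notin C
                         & connect (erel_avoid C) e d]].

Definition npath (u v : V) : bool := (u == v) || npath_avoid set0 u v.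

Definition mincut (u v : V) : nat :=
  \big[minn/#|E|]_(C : {set E} | ~~ npath_avoid C u v) #|C|.

Definition acyclic : bool :=
  [forall e, forall d, connect erel e d ==> (head d != tail e)].

Definition is_source (v : V) : bool := [exists i, sigma i == v].

Definition wf_network : Prop :=
  [/\ acyclic,
      injective sigma,
      (forall v, is_source v = ~~ [exists e, head e == v]),
      ~~ is_source rho
    & (forall e, tail e != rho) /\ (forall v, v != rho -> npath v rho)].

Definition separates (X : {set E}) (U : {set V}) (C : {set E}) : bool :=
  [forall u in U, forall e in X, ~~ reach_avoid C u e].

Definition is_mincut (X : {set E}) (U : {set V}) (C : {set E}) : bool :=
  separates X U C && [forall C' : {set E}, separates X U C' ==> (#|C| <= #|C'|)].

Definition is_primary (X : {set E}) (U : {set V}) (C : {set E}) : bool :=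
  is_mincut X U C && [forall C' : {set E}, is_mincut X U C' ==> separates C' U C].

Definition DW (W : {set E}) : {set V} :=
  [set v | is_source v && [exists e in W, reach v e]].

(* \widehat W : the (unique) primary minimum cut separating W from D_W *)
Definition widehat (W : {set E}) : {set E} :=
  odflt W [pick C : {set E} | is_primary W (DW W) C].

Definition Cmin : nat := \big[minn/#|E|]_(i < s) mincut (sigma i) rho.

Definition Wstar (r : nat) : {set {set E}} :=
  [set W : {set E} | (#|W| == r) && (W == widehat W)].

Variable F : finFieldType.
Local Open Scope ring_scope.

Definition src_index (v : V) : option 'I_s := [pick i | sigma i == v].

Record lsn_code (l n : nat) := LSNCode {
  keylen : 'I_s -> nat;
  srcA : forall i : 'I_s, E -> 'M[F]_(l + keylen i, n);
  locA : E -> E -> 'M[F]_n;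
  dec : {ffun E -> 'rV[F]_n} -> 'rV[F]_l                  (* decoder, applied to
                                             the messages on E_in(rho) *)
}.

Section Code.
Variables (l n : nat) (C : lsn_code l n).

Definition msg_space := {ffun 'I_s -> 'rV[F]_l}.
Definition key_space := {dffun forall i : 'I_s, 'rV[F]_(keylen C i)}.

Definition code_eqs (m : msg_space) (k : key_space) (y : {ffun E -> 'rV[F]_n}) : bool :=
  [forall e, y e ==
     match src_index (tail e) with
     | Some i => row_mx (m i) (k i) *m srcA C i e
     | None => \sum_(d | head d == tail e) y d *m locA C d e
     end].

(* the messages transmitted on all edges (the unique solution of the
   equations, which exists by acyclicity) *)
Definition msgs (m : msg_space) (k : key_space) : {ffun E -> 'rV[F]_n} :=
  odflt [ffun => 0] [pick y | code_eqs m k y].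

Definition restrict (W : {set E}) (y : {ffun E -> 'rV[F]_n}) : {ffun E -> 'rV[F]_n} :=
  [ffun e => if e \in W then y e else 0].

(* Sample space: (M_S, K_S), uniform, so that all message and key entries
   are i.i.d. uniform over F and mutually independent. *)
Definition Omega := (msg_space * key_space)%type.

Definition YW (W : {set E}) (w : Omega) := restrict W (msgs w.1 w.2).
Definition MS (w : Omega) : msg_space := w.1.

Definition admissible (r : nat) : Prop :=
  (forall m k, dec C (restrict [set e | head e == rho] (msgs m k)) = \sum_(i < s) m i)
  /\ (forall W : {set E}, (#|W| <= r)%N -> mutinfo (YW W) MS = 0%R).
End Code.

End Network.

(* Main.v *)
Require Import Defs.
From HB Require Import structures.
From mathcomp Require Import all_boot all_order all_algebra.
From mathcomp Require Import Rstruct.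
From Stdlib Require Rpower.
Set Implicit Arguments.
Unset Strict Implicit.
Unset Printing Implicit Defensive.
Import GRing.Theory.

(** Each edge [e] is given a vector [v e], the effect at the sink of a unit
    symbol put on [e], and [v e] must lie in the span of the vectors of the
    edges following [e].  If the edges leaving every source carry vectors
    spanning the whole space of dimension [R = (R - r) + r], each source can
    make the sink see any vector, and the sink sees the sum of the vectors
    injected by the sources.  Such vectors are chosen edge by edge from the
    sink backwards.  In place of Menger's theorem, the invariant is that every
    cut between a source and the sink, where treated edges count through the
    rank of their vectors, has value at least [R]; by submodularity each source
    forbids a single proper subspace at each step.

    For security, source [i] injects [m_i Bm + k_i Bk].  An edge set [W] learns
    nothing if for every source the rows of [Bk] together with the kernel of
    the map from injected vectors to the symbols on [W] span everything.  The
    [r] rows of [Bk] are chosen one at a time outside the sums of these kernels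
    with the previous rows, as long as these are proper; this needs one
    condition per source and per edge set.  Only the sets of [Wstar] matter,
    because any [W] of size at most [r] is separated from all the sources by
    one of them, namely any set of at most [r] edges separating [W] from the
    sources which leaves as few edges as possible reachable. *)


(** * Avoiding few subspaces over a large field *)

Section Avoidance.
Local Open Scope ring_scope.
Variables (F : finFieldType) (n : nat).

(** Induction on the list. If the vector [w] found for the tail falls into the new [U], move along
    the line [u + t *: w] with [u] in [S] outside [U]: it misses [U] entirely and meets each
    relevant subspace of the tail at most once. *)
Lemma avoid_subspaces m (S : 'M[F]_(m, n)) (Us : seq 'M[F]_n) :
  (size Us < #|F|)%N ->
  exists2 w : 'rV[F]_n, (w <= S)%MS &
    {in Us, forall U, ~~ (S <= U)%MS -> ~~ (w <= U)%MS}.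
Proof.
elim: Us => [|U Us IH] ltUs; first by exists 0; rewrite ?sub0mx.
have [w wS wUs] := IH (ltnW ltUs).
have [SU|nSU] := boolP (S <= U)%MS.
  by exists w => // U'; rewrite inE => /orP[/eqP->|/wUs//]; rewrite SU.
have [wU|nwU] := boolP (w <= U)%MS; last first.
  by exists w => // U'; rewrite inE => /orP[/eqP->|/wUs].
have /row_subPn[i nuU] := nSU; set u := row i S in nuU.
have uS : (u <= S)%MS := row_sub i S.
pose bad (t : F) (U : 'M_n) := ~~ (S <= U)%MS && ((u + t *: w)%R <= U)%MS.
have [/existsP[t /hasPn good]|/existsPn allbad] :=
  boolP [exists t, ~~ has (bad t) Us].
  exists (u + t *: w); first by rewrite addmx_sub ?scalemx_sub.
  move=> U'; rewrite inE => /orP[/eqP-> _|/good].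
    apply: contra nuU => uwU; rewrite -(addrK (t *: w) u) addmx_sub //.
    by rewrite -scaleNr scalemx_sub.
  by rewrite /bad negb_and => + nS; rewrite nS.
have {}allbad t : has (bad t) Us by have := allbad t; rewrite negbK.
(* Pigeonhole: each of the [#|F|] scalars is sent to its first bad subspace, and a subspace shared
   by two scalars would contain [w]. *)
pose f t : 'I_(size Us) := Ordinal (etrans (esym (has_find (bad t) Us)) (allbad t)).
have : injective f.
  move=> t1 t2 /(congr1 val)/= eqf; apply/eqP/negPn/negP => neq.
  have /andP[nS b1] := nth_find 0 (allbad t1).
  have /andP[_ b2] := nth_find 0 (allbad t2).
  rewrite -eqf in b2; set U' := nth _ _ _ in b1 b2 nS.
  have U'in : U' \in Us by rewrite mem_nth // -has_find.
  have /negP := wUs _ U'in nS; apply.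
  have : ((t1 - t2) *: w <= U')%MS.
    have -> : (t1 - t2) *: w = (u + t1 *: w) - (u + t2 *: w).
      by rewrite opprD addrACA subrr add0r scalerBl.
    by rewrite addmx_sub // -scaleN1r scalemx_sub.
  by move/(scalemx_sub (t1 - t2)^-1); rewrite scalerA mulVf ?scale1r // subr_eq0.
by move/leq_card; rewrite card_ord leqNgt (ltnW ltUs).
Qed.

(** Each new row is taken outside all sums [N + K] that are still proper, so it raises the rank of
    all of them at once. *)
Lemma common_supplement r (Ns : seq 'M[F]_n) :
    (size Ns < #|F|)%N -> {in Ns, forall N, (n <= \rank N + r)%N} ->
  exists K : 'M[F]_(r, n), {in Ns, forall N, (1%:M <= N + K)%MS}.
Proof.
move=> ltNs; suff [K rkK] : exists K : 'M[F]_(r, n),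
    {in Ns, forall N, (1%:M <= N + K)%MS || (\rank N + r <= \rank (N + K)%MS)%N}.
  move=> codim; exists K => N NNs; have /orP[//|] := rkK N NNs.
  by move/(leq_trans (codim N NNs)); rewrite sub1mx col_leq_rank.
elim: r => [|r [K rkK]].
  by exists 0 => N _; rewrite addn0 mxrankS ?orbT // addsmxSl.
have [|w _ avoid] := @avoid_subspaces _ 1%:M [seq (N + K)%MS | N <- Ns].
  by rewrite size_map.
exists (col_mx w K) => N NNs.
have subK : (N + K <= N + col_mx w K)%MS.
  by rewrite addsmxS // -addsmxE addsmxSr.
have [full|nfull] := boolP (1%:M <= N + K)%MS; first by rewrite (submx_trans full).
have := rkK N NNs; rewrite (negPf nfull) /= => rk; apply/orP; right.
have := avoid _ (map_f _ NNs) nfull => nw.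
rewrite addnS; apply: leq_ltn_trans rk _.
rewrite ltn_neqAle mxrankS // andbT (mxrank_leqif_sup subK).2.
apply: contra nw; apply: submx_trans; apply: submx_trans (addsmxSr N _).
by rewrite -addsmxE addsmxSl.
Qed.

(** The first [r] rows of the invertible [row_ebase K] span at least the rows of [K]; the others
    carry the message, which the last [l] columns [D] of the inverse extract. *)
Lemma complete_rows r l (K : 'M[F]_(r, r + l)) :
  exists Bm : 'M[F]_(l, r + l), exists Bk : 'M[F]_(r, r + l),
  exists D : 'M[F]_(r + l, l),
    [/\ (K <= Bk)%MS, Bm *m D = 1%:M & Bk *m D = 0].
Proof.
pose U := row_ebase K; exists (dsubmx U), (usubmx U), (rsubmx (invmx U)).
have UV : U *m invmx U = 1%:M by rewrite mulmxV // row_ebase_unit.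
have eqU : col_mx (usubmx U) (dsubmx U) *m row_mx (lsubmx (invmx U)) (rsubmx (invmx U))
  = block_mx 1%:M 0 0 1%:M.
  by rewrite vsubmxK hsubmxK UV -scalar_mx_block.
move: eqU; rewrite mul_col_row => /eq_block_mx[_ Ukm _ Umm]; split=> //.
rewrite -{1}[K]mulmx_ebase.
have -> : pid_mx (\rank K) = (pid_mx (\rank K) : 'M_r) *m pid_mx r :> 'M[F]_(r, r + l).
  by rewrite mul_pid_mx (minn_idPl (rank_leq_row K)) (minn_idPr (rank_leq_row K)).
rewrite pid_mx_row -[row_ebase K]vsubmxK -!mulmxA mul_row_col mul1mx mul0mx addr0.
by rewrite mulmxA submxMl.
Qed.

End Avoidance.

(** * Bounds on minimum cuts *)

Lemma bigminn_leq (I : finType) (P : pred I) (f : I -> nat) k i :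
  P i -> (\big[minn/k]_(j | P j) f j <= f i)%N.
Proof.
move=> Pi; have : i \in index_enum I by rewrite mem_index_enum.
elim: (index_enum I) => // j r IH; rewrite inE big_cons => /orP[/eqP<-|/IH le].
  by rewrite Pi geq_minl.
by case: ifP => // _; apply: leq_trans (geq_minr _ _) le.
Qed.

Section Cuts.
Variables (V E : finType) (tail head : E -> V).

Lemma mincut_leq (C : {set E}) u v :
  ~~ npath_avoid tail head C u v -> (mincut tail head u v <= #|C|)%N.
Proof. exact: (bigminn_leq (fun C : {set E} => #|C|)). Qed.

Lemma npath_avoid_lt_mincut (C : {set E}) u v :
  (#|C| < mincut tail head u v)%N -> npath_avoid tail head C u v.
Proof. by apply: contraTT => /mincut_leq; rewrite -leqNgt. Qed.

Lemma Cmin_leq s (sigma : 'I_s -> V) rho i :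
  (Cmin tail head sigma rho <= mincut tail head (sigma i) rho)%N.
Proof. exact: (bigminn_leq (fun i => mincut tail head (sigma i) rho)). Qed.

End Cuts.

(** * Induction and recursion along the acyclic graph *)

Section Topology.
Variables (V E : finType) (tail head : E -> V).

Definition depth (e : E) := #|[set d | connect (erel tail head) d e]|.

Lemma depth_ltn d e :
  acyclic tail head -> head d = tail e -> (depth d < depth e)%N.
Proof.
move=> /forallP acyc hde; apply: proper_card; apply/properP; split.
  apply/subsetP => c; rewrite !inE => cd; apply: connect_trans cd (connect1 _).
  by rewrite /erel hde.
exists e; first by rewrite inE.
rewrite inE; apply/negP => ed.
by have /forallP/(_ d)/implyP/(_ ed) := acyc e; rewrite hde eqxx.
Qed.

(** Iterating [step] from a constant function, the value at [e] no longer changes after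
    [depth e + 1] rounds. *)
Lemma topological_recursion (T : Type) (x0 : T) (step : E -> (E -> T) -> T) :
    acyclic tail head ->
    (forall e f f', (forall d, head d = tail e -> f d = f' d) ->
       step e f = step e f') ->
  exists f : E -> T, forall e, f e = step e f.
Proof.
move=> acyc local; pose Phi (f : E -> T) e := step e f.
pose it k := iter k Phi (fun=> x0).
have stab k k' e : (depth e < k)%N -> (depth e < k')%N -> it k e = it k' e.
  elim: k k' e => [|k IH] [|k'] e // ltk ltk'.
  apply: local => d hd; have lt := depth_ltn acyc hd.
  by apply: IH; [apply: leq_trans lt ltk | apply: leq_trans lt ltk'].
exists (fun e => it (depth e).+1 e) => e /=.
by apply: local => d hd; apply: (stab (depth e) (depth d).+1); rewrite ?depth_ltn.
Qed.

End Topology.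

(** * Backward choice of the edge vectors *)

Section Multicast.
Local Open Scope ring_scope.
Variables (V E : finType) (tail head : E -> V) (s : nat).
Variables (sigma : 'I_s -> V) (rho : V) (F : finFieldType) (n : nat).

Implicit Types (P X Y : {set E}) (v : E -> 'rV[F]_n) (i : 'I_s).

(* The subspace in which the vector of [e] may be chosen once the vectors of
   its successors are known; it is the whole space for the edges into [rho]. *)
Definition succ_span v (e : E) : 'M[F]_n :=
  if head e == rho then 1%:M else (\sum_(d | tail d == head e) <<v d>>)%MS.

(** With [X] as the source side of a cut, the edges of [entered i X] outside [X] are the cut
    edges. *)
Definition entered i X : {set E} :=
  [set e | (tail e == sigma i) || [exists d in X, head d == tail e]].

Definition cut_span v i X : 'M[F]_n :=
  ((\sum_(e | tail e == sigma i) <<v e>>) + \sum_(d in X) succ_span v d)%MS.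

(* A rank-weighted cut value: unprocessed edges (those outside [P]) count for
   one each, processed ones through the span of their vectors. *)
Definition cut_value P v i X : nat :=
  (#|entered i X :\: P :\: X| + \rank (cut_span v i X))%N.

Lemma mem_entered i X e :
  (e \in entered i X) = (tail e == sigma i) || [exists d in X, head d == tail e].
Proof. by rewrite inE. Qed.

Lemma enteredS i X Y : X \subset Y -> entered i X \subset entered i Y.
Proof.
move=> sXY; apply/subsetP => e; rewrite !inE => /orP[->//|/exists_inP[d dX hd]].
by apply/orP; right; apply/exists_inP; exists d => //; apply: (subsetP sXY).
Qed.

Lemma enteredU i X Y : entered i (X :|: Y) = entered i X :|: entered i Y.
Proof.
apply/eqP; rewrite eqEsubset subUset !enteredS ?subsetUl ?subsetUr // !andbT.
apply/subsetP => e; rewrite !inE => /orP[->//|/exists_inP[d]].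
rewrite inE => /orP[dX|dY] hd.
  suff -> : [exists d in X, head d == tail e] by rewrite orbT.
  by apply/exists_inP; exists d.
suff -> : [exists d in Y, head d == tail e] by rewrite !orbT.
by apply/exists_inP; exists d.
Qed.

Lemma cut_spanS v i X Y : X \subset Y -> (cut_span v i X <= cut_span v i Y)%MS.
Proof.
move=> sXY; rewrite addsmxS //; apply/sumsmx_subP => d dX.
by rewrite (sumsmx_sup d) // (subsetP sXY).
Qed.

Lemma cut_spanU v i X Y :
  (cut_span v i (X :|: Y) <= cut_span v i X + cut_span v i Y)%MS.
Proof.
rewrite /cut_span addsmx_sub; apply/andP; split.
  by apply: submx_trans (addsmxSl _ _); apply: addsmxSl.
apply/sumsmx_subP => d; rewrite inE => /orP[dX|dY].
  apply: submx_trans (addsmxSl _ _); apply: submx_trans (addsmxSr _ _).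
  by rewrite (sumsmx_sup d).
apply: submx_trans (addsmxSr _ _); apply: submx_trans (addsmxSr _ _).
by rewrite (sumsmx_sup d).
Qed.

(** The cardinality part is compared edge by edge; the rank part follows from the dimension formula
    for the sum and intersection of two subspaces. *)
Lemma cut_value_submod P v i X Y :
  (cut_value P v i (X :|: Y) + cut_value P v i (X :&: Y) <=
   cut_value P v i X + cut_value P v i Y)%N.
Proof.
rewrite /cut_value addnACA [leqRHS]addnACA leq_add //.
  set D := fun Z => entered i Z :\: P :\: Z.
  rewrite -!/(D _) -[leqLHS]cardsUI -[leqRHS]cardsUI leq_add // subset_leq_card //.
    apply/subsetP => e; have := subsetP (enteredS i (subsetIl X Y)) e.
    have := subsetP (enteredS i (subsetIr X Y)) e.
    rewrite /D enteredU !in_setU !in_setD !in_setU !in_setI.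
    by case: (e \in entered i X) (e \in entered i Y) (e \in entered i (_ :&: _))
      (e \in X) (e \in Y) (e \in P) => [] [] [] [] [] [] // => [/(_ isT)|_ /(_ isT)].
  apply/subsetP => e; have := subsetP (enteredS i (subsetIl X Y)) e.
  have := subsetP (enteredS i (subsetIr X Y)) e.
  rewrite /D enteredU !in_setI !in_setD !in_setU !in_setI.
  by case: (e \in entered i X) (e \in entered i Y) (e \in entered i (_ :&: _))
    (e \in X) (e \in Y) (e \in P) => [] [] [] [] [] [] // => [/(_ isT)|_ /(_ isT)].
rewrite -[leqRHS]mxrank_sum_cap leq_add ?mxrankS ?cut_spanU //.
by rewrite sub_capmx !cut_spanS ?subsetIl ?subsetIr.
Qed.

Lemma succ_span_mono v v' e : (forall d, (v d <= v' d)%MS) ->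
  (succ_span v e <= succ_span v' e)%MS.
Proof.
move=> le; rewrite /succ_span; case: ifP => // _.
by apply/sumsmx_subP => d te; rewrite (sumsmx_sup d) // !genmxE.
Qed.

Lemma cut_span_mono v v' i X : (forall d, (v d <= v' d)%MS) ->
  (cut_span v i X <= cut_span v' i X)%MS.
Proof.
move=> le; rewrite addsmxS //; apply/sumsmx_subP => d dX.
  by rewrite (sumsmx_sup d) // !genmxE.
by rewrite (sumsmx_sup d) // succ_span_mono.
Qed.

Lemma mem_cut_span v i X e :
    e \in entered i X -> (forall d, head d = tail e -> head d != rho) ->
  (v e <= cut_span v i X)%MS.
Proof.
move=> + nrho; rewrite mem_entered => /orP[te|/exists_inP[d dX /eqP hd]].
  by apply: submx_trans (addsmxSl _ _); rewrite (sumsmx_sup e) // genmxE.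
apply: submx_trans (addsmxSr _ _); rewrite (sumsmx_sup d) //.
by rewrite /succ_span (negPf (nrho _ hd)) (sumsmx_sup e) ?genmxE // hd.
Qed.


Definition processed P v := [/\
  forall e d, e \in P -> head e = tail d -> d \in P,
  forall e, e \notin P -> v e = 0,
  forall e, e \in P -> (v e <= succ_span v e)%MS
  & forall i X, X \subset ~: P -> (n <= cut_value P v i X)%N].

(** The cuts without slack in which [e] counts: treating [e] removes its unit weight, which a larger
    rank must replace. *)
Definition tight P v i e X :=
  [&& X \subset ~: P, e \in entered i X, e \notin X & cut_value P v i X == n].

(** Uncrossing: the values of union and intersection add up to at most [2n], and each is at least
    [n]. *)
Lemma tightU P v i e X Y :
  processed P v -> tight P v i e X -> tight P v i e Y -> tight P v i e (X :|: Y).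
Proof.
move=> [_ _ _ big] /and4P[XP eX nX /eqP gX] /and4P[YP eY nY /eqP gY].
have UP : X :|: Y \subset ~: P by rewrite subUset XP.
rewrite /tight UP enteredU !in_setU eX (negPf nX) (negPf nY) /= eqn_leq big // andbT.
have := cut_value_submod P v i X Y; rewrite gX gY.
have /(big i) : X :&: Y \subset ~: P by rewrite subIset ?XP.
by move=> geI leUI; rewrite -(leq_add2r n) (leq_trans _ leUI) // leq_add2l.
Qed.

Lemma entered_insert P i X e :
    e \notin P -> (forall d, head e = tail d -> d \in P) ->
    e \in entered i X -> e \notin X ->
  (#|entered i (e |: X) :\: P :\: (e |: X)| < #|entered i X :\: P :\: X|)%N.
Proof.
move=> eP succP eX nX; apply: proper_card; apply/properP; split; last first.
  by exists e; rewrite !in_setD ?eP ?nX // in_setU1 eqxx.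
apply/subsetP => d; rewrite !in_setD in_setU1 negb_or -andbA => /and4P[_ -> dP] /=.
rewrite dP mem_entered inE /= => /orP[->//|/exists_inP[c]].
rewrite in_setU1 => /orP[/eqP-> /eqP/succP|cX hc]; first by rewrite (negPf dP).
by apply/orP; right; apply/exists_inP; exists c.
Qed.

(** Otherwise moving [e] into [X] would lower the count without enlarging the span, and the value
    would fall below [n]. *)
Lemma tight_succ_span P v i e X : processed P v -> e \notin P ->
    (forall d, head e = tail d -> d \in P) -> tight P v i e X ->
  ~~ (succ_span v e <= cut_span v i X)%MS.
Proof.
move=> [_ _ _ big] eP succP /and4P[XP eX nX /eqP gX]; apply/negP => SU.
have /(big i) : e |: X \subset ~: P by rewrite subUset XP sub1set inE eP.
rewrite leqNgt -[X in (_ < X)%N]gX /cut_value => /negP[].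
rewrite -addSn leq_add ?entered_insert ?mxrankS //.
rewrite addsmx_sub addsmxSl; apply/sumsmx_subP => d; rewrite in_setU1.
case/orP=> [/eqP->//|dX]; apply: submx_trans (addsmxSr _ _).
by rewrite (sumsmx_sup d).
Qed.

(* Submodularity leaves a single subspace to avoid per source, the one of the
   union of all tight sets; hence [s < q] is enough. *)
Lemma tight_bound P v i e : processed P v -> e \notin P ->
    (forall d, head e = tail d -> d \in P) ->
  exists U : 'M[F]_n, forall X, tight P v i e X ->
    ~~ (succ_span v e <= U)%MS /\ (cut_span v i X <= U)%MS.
Proof.
move=> proc eP succP; pose Z := \bigcup_(X | tight P v i e X) X.
exists (cut_span v i Z) => X tX; have sXZ : X \subset Z by apply: bigcup_sup.
split; last exact: cut_spanS.
apply: tight_succ_span (eP) (succP) _ => //.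
have : (Z == set0) || tight P v i e Z.
  apply: (big_ind (fun Z => (Z == set0) || tight P v i e Z)) => [|A B|A ->].
  - by rewrite eqxx.
  - case/orP=> [/eqP->|tA]; first by rewrite set0U.
    case/orP=> [/eqP->|tB]; first by rewrite setU0 tA orbT.
    by rewrite tightU // orbT.
  - by rewrite orbT.
case/orP=> // /eqP Z0; suff -> : Z = X by [].
by apply/eqP; rewrite eqEsubset sXZ Z0 sub0set.
Qed.

Lemma processed_step P v e :
    (s < #|F|)%N -> (forall d, tail d != rho) ->
    processed P v -> e \notin P -> (forall d, head e = tail d -> d \in P) ->
  exists v', processed (e |: P) v'.
Proof.
move=> qs nrho proc eP succP; have [closed v0 vS big] := proc.
have [U Ub] : exists U : {ffun 'I_s -> 'M[F]_n}, forall i X, tight P v i e X ->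
    ~~ (succ_span v e <= U i)%MS /\ (cut_span v i X <= U i)%MS.
  have /fin_all_exists[U Ub] := fun i => tight_bound i proc eP succP.
  by exists [ffun i => U i] => i X /Ub; rewrite ffunE.
have [|w wS wU] := @avoid_subspaces F n _ (succ_span v e) (codom U).
  by rewrite size_codom card_ord.
pose v' d := if d == e then w else v d.
have le d : (v d <= v' d)%MS.
  by rewrite /v'; case: eqP => // ->; rewrite v0 ?sub0mx.
have v'e : v' e = w by rewrite /v' eqxx.
exists v'; split.
- move=> c d; rewrite !in_setU1 => /orP[/eqP->|cP] hc; first by rewrite succP ?orbT.
  by rewrite (closed c) ?orbT.
- by move=> d; rewrite in_setU1 negb_or /v' => /andP[/negPf-> /v0].
- move=> d; rewrite in_setU1; case: (eqVneq d e) => [-> _|ne /= dP].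
    by rewrite v'e (submx_trans wS) // succ_span_mono.
  by rewrite {1}/v' (negPf ne) (submx_trans (vS d dP)) // succ_span_mono.
move=> i X XeP; have XP : X \subset ~: P.
  by apply: subset_trans XeP _; rewrite setCS subsetUr.
have nX : e \notin X.
  by apply/negP => /(subsetP XeP); rewrite !inE eqxx.
have sub : (cut_span v i X <= cut_span v' i X)%MS by apply: cut_span_mono.
have ge := big i X XP.
have [eX|neX] := boolP (e \in entered i X); last first.
  apply: leq_trans ge _; rewrite leq_add ?mxrankS // subset_leq_card //.
  apply/subsetP => d; rewrite !in_setD in_setU1 negb_or => /and3P[-> -> dX] /=.
  by rewrite dX !andbT; apply: contra neX => /eqP<-.
have cardE : #|entered i X :\: P :\: X| = #|entered i X :\: (e |: P) :\: X|.+1.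
  rewrite (cardsD1 e) !in_setD eP nX eX add1n; congr _.+1.
  apply: eq_card => d; rewrite !in_setD in_setU1 in_set1 negb_or.
  by case: (d == e); rewrite ?andbF.
(* The weight of [e] is lost. A cut with slack absorbs this; a tight one gains a dimension, since
   [w] avoids its span. *)
rewrite /cut_value; case: (ltngtP n (cut_value P v i X)) ge => // [gt|eqn] _.
  rewrite -ltnS -addSn -cardE (leq_trans gt) // leq_add2l mxrankS //.
have tX : tight P v i e X by rewrite /tight XP eX nX -eqn eqxx.
have [nS subU] := Ub i X tX.
have nw : ~~ (w <= cut_span v i X)%MS.
  apply: contra (wU (U i) (codom_f _ _) nS) => /submx_trans; exact.
rewrite {1}eqn /cut_value cardE addSnnS leq_add2l.
rewrite ltn_neqAle mxrankS // andbT (mxrank_leqif_sup sub).2.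
apply: contra nw; apply: submx_trans; rewrite -v'e.
by apply: mem_cut_span => // d ->.
Qed.


(** If [X] contains an edge into [rho], the span is the whole space. Otherwise the entered edges
    outside [X] cut the source from [rho], as a path avoiding them stays in [X]. *)
Lemma processed0 :
  (forall i, (n <= mincut tail head (sigma i) rho)%N) -> processed set0 (fun=> 0).
Proof.
move=> cut; split=> [e d|//|e|i X _]; rewrite ?inE //.
have [/exists_inP[d dX dr]|nX] := boolP [exists d in X, head d == rho].
  apply: leq_trans (leq_addl _ _); rewrite col_leq_rank -sub1mx.
  apply: submx_trans (addsmxSr _ _).
  by rewrite (sumsmx_sup d) // /succ_span dr.
apply: leq_trans (cut i) _; rewrite /cut_value setD0; apply: leq_trans (leq_addr _ _).
apply: mincut_leq; apply: contra nX => /existsP[e /existsP[d /and5P[te hd eC dC]]].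
have entX c : c \notin entered i X :\: X -> c \in entered i X -> c \in X.
  by rewrite in_setD => + cE; rewrite cE andbT negbK.
have eX : e \in X by rewrite entX // mem_entered te.
case/connectP=> p pth dl; apply/exists_inP; exists d => //.
elim: p e {te eC} eX pth dl => [|c p IH] e eX /=; first by move=> _ ->.
case/andP=> /and3P[_ cC ec]; apply: IH; apply: entX => //.
by rewrite mem_entered; apply/orP; right; apply/exists_inP; exists e.
Qed.

Theorem backward_vectors :
    acyclic tail head -> (forall d, tail d != rho) -> (s < #|F|)%N ->
    (forall i, (n <= mincut tail head (sigma i) rho)%N) ->
  exists v, (forall e, (v e <= succ_span v e)%MS) /\
    forall i, (1%:M <= \sum_(e | tail e == sigma i) <<v e>>)%MS.
Proof.
move=> acyc nrho qs cut.
suff [v [_ _ vS big]] : exists v, processed [set: E] v.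
  exists v; split=> [e|i]; first by rewrite vS ?inE.
  (* Once all edges are treated, the cut with empty [X] measures just the span at the source. *)
  have := big i set0 (sub0set _).
  rewrite /cut_value setDT set0D cards0 add0n /cut_span big_set0 => rk.
  rewrite sub1mx -col_leq_rank; apply: leq_trans rk _.
  by rewrite mxrankS // addsmx_sub submx_refl sub0mx.
have: exists v, processed set0 v by exists (fun=> 0); apply: processed0.
move: (set0 : {set E}) => P; have [k] := ubnP #|~: P|; elim: k P => // k IH P.
have [/setP PE|[e0 e0P]] := set_0Vmem (~: P).
  by suff -> : P = setT by []; apply/setP => e; have := PE e; rewrite !inE => /negbFE.
(* An untreated edge of maximal depth has only treated successors. *)
move=> leP [v proc]; case: (arg_maxnP (depth tail head) e0P) => e eP emax.
have succP d : head e = tail d -> d \in P.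
  move=> /(depth_ltn acyc) lt; apply: contraLR lt; rewrite -leqNgt -in_setC.
  exact: emax.
have eP' : e \notin P by rewrite -in_setC.
have [v' proc'] := processed_step qs nrho proc eP' succP.
apply: (IH (e |: P)); last by exists v'.
rewrite -ltnS (leq_trans _ leP) // ltnS setCU; apply: proper_card.
by rewrite setIC -setDE properD1.
Qed.

End Multicast.

(** * Separating sets nearest the sources *)

Section SeparatingSets.
Variables (V E : finType) (tail head : E -> V) (s : nat).
Variables (sigma : 'I_s -> V) (rho : V).
Implicit Types (C W X : {set E}) (e d : E).

Definition unsep C : {set E} :=
  [set e | [exists i, reach_avoid tail head C (sigma i) e]].

Lemma unsep_notin C e : e \in unsep C -> e \notin C.
Proof. by rewrite inE => /existsP[i /existsP[d /and4P[]]]. Qed.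

Lemma unsep_source C i e : tail e = sigma i -> e \notin C -> e \in unsep C.
Proof.
move=> te eC; rewrite inE; apply/existsP; exists i; apply/existsP; exists e.
by rewrite te eqxx eC connect0.
Qed.

Lemma unsep_succ C d e :
  d \in unsep C -> head d = tail e -> e \notin C -> e \in unsep C.
Proof.
move=> dR hd eC; have dC := unsep_notin dR; move: dR.
rewrite !inE => /existsP[i /existsP[c /and4P[tc cC _ cd]]].
apply/existsP; exists i; apply/existsP; exists c; rewrite tc cC eC /=.
by apply: connect_trans cd (connect1 _); rewrite /erel_avoid dC eC /erel hd eqxx.
Qed.

Lemma unsep_min C X :
    (forall i e, tail e = sigma i -> e \notin C -> e \in X) ->
    (forall d e, d \in X -> head d = tail e -> e \notin C -> e \in X) ->
  unsep C \subset X.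
Proof.
move=> src step; apply/subsetP => e.
rewrite inE => /existsP[i /existsP[d /and4P[/eqP td dC _ /connectP[p pth ->]]]].
elim: p d {td dC} (src i d td dC) pth => //= d p IH c cX.
case/andP=> /and3P[_ dC /eqP hc]; apply: IH; exact: step cX hc dC.
Qed.

(** A path from a source avoiding [C] stays in [unsep C], hence also avoids [C']. *)
Lemma unsep_sub C C' : [disjoint C' & unsep C] -> unsep C \subset unsep C'.
Proof.
move=> dis; suff: unsep C \subset unsep C :&: unsep C' by rewrite subsetI => /andP[].
have nC' e : e \in unsep C -> e \notin C' by apply: contraTN => /(disjointFr dis)->.
apply: unsep_min => [i e te eC|d e]; rewrite !in_setI.
  have eR := unsep_source te eC.
  by rewrite eR (unsep_source te) ?nC'.
case/andP=> dR dR' hd eC; have eR := unsep_succ dR hd eC.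
by rewrite eR (unsep_succ dR' hd) ?nC'.
Qed.

Definition covers r W C := (#|C| <= r)%N && [disjoint W & unsep C].

Definition nearest r W C :=
  covers r W C && [forall C', covers r W C' ==> (#|unsep C| <= #|unsep C'|)%N].

Lemma nearest_exists r W : (#|W| <= r)%N -> exists C, nearest r W C.
Proof.
move=> leW; have covW : covers r W W.
  rewrite /covers leW; apply/pred0P => e /=; apply/andP => -[eW /unsep_notin].
  by rewrite eW.
case: (arg_minnP (fun C => #|unsep C|) covW) => C covC minC.
by exists C; rewrite /nearest covC; apply/forall_inP.
Qed.

Lemma unsep_neq0 C i :
  (#|C| < mincut tail head (sigma i) rho)%N -> unsep C != set0.
Proof.
move/npath_avoid_lt_mincut => /existsP[e /existsP[d /and5P[/eqP te _ eC _ _]]].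
by apply/set0Pn; exists e; apply: unsep_source te eC.
Qed.

(* A smaller set could absorb one of the edges it fails to separate. *)
Lemma nearest_card r W C i : (r <= mincut tail head (sigma i) rho)%N ->
  nearest r W C -> #|C| = r.
Proof.
move=> cut /andP[/andP[leC dis] /forallP minC]; apply/eqP; rewrite eqn_leq leC leqNgt.
apply/negP => ltC; have /set0Pn[e eR] := unsep_neq0 (leq_trans ltC cut).
have sub : unsep (e |: C) \subset unsep C.
  apply: unsep_min => [j d td|c d cR hd]; rewrite in_setU1 negb_or => /andP[_ dC].
    exact: unsep_source td dC.
  exact: unsep_succ cR hd dC.
have lt : (#|unsep (e |: C)| < #|unsep C|)%N.
  apply: proper_card; apply/properP; split=> //.
  by exists e => //; apply: contraL (setU11 e C); apply: unsep_notin.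
have := minC (e |: C); rewrite leqNgt lt implybF => /negP[].
by rewrite /covers cardsU1 (unsep_notin eR) add1n ltC (disjointWr sub).
Qed.

Lemma separates_DW_unsep W C :
  separates tail head W (DW tail head sigma W) C -> [disjoint W & unsep C].
Proof.
move=> /forall_inP sep; apply/pred0P => e /=; apply/andP => -[eW].
rewrite inE => /existsP[i reCe].
suff /sep/forall_inP/(_ e eW) : sigma i \in DW tail head sigma W by rewrite reCe.
rewrite inE; apply/andP; split; first by apply/existsP; exists i.
apply/exists_inP; exists e => //; move: reCe => /existsP[d /and4P[td dC eC cde]].
apply/existsP; exists d; rewrite td !inE /=.
apply: connect_sub cde => x y /and3P[_ _ xy]; apply: connect1.
by rewrite /erel_avoid !inE.
Qed.

(** A primary cut [C'] of [C] is again nearest, with the same unseparated edges. An edge of [C']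
    outside [C] could be dropped from [C'] without making more edges reachable, leaving a nearest
    set with fewer than [r] edges. *)
Lemma nearest_widehat r W C i : (r <= mincut tail head (sigma i) rho)%N ->
  nearest r W C -> widehat tail head sigma C = C.
Proof.
move=> cut nC; have /andP[/andP[leC dis] /forallP minC] := nC.
(* If no primary cut is picked, the default value of [widehat] is [C] itself. *)
rewrite /widehat; case: pickP => //= C' /andP[/andP[sep /forallP/(_ C)] + _].
have -> : separates tail head C (DW tail head sigma C) C.
  apply/forall_inP => u _; apply/forall_inP => e eC; apply/existsP => -[d].
  by rewrite eC /= !andbF.
move=> /= leC'; have subR := unsep_sub (separates_DW_unsep sep).
have covC' : covers r W C' by rewrite /covers (leq_trans leC') ?(disjointWr subR).
have nC' : nearest r W C'.
  rewrite /nearest covC'; apply/forall_inP => X /(implyP (minC X)).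
  exact: leq_trans (subset_leq_card subR).
have eqR : unsep C' = unsep C.
  by apply/eqP; rewrite eqEcard subR; apply: (implyP (minC C')).
have cC := nearest_card cut nC; have cC' := nearest_card cut nC'.
apply/eqP; rewrite eqEcard cC cC' leqnn andbT; apply/subsetP => c cC'in.
apply: contraT => ncC.
have subD : unsep (C' :\ c) \subset unsep C'.
  have ncR : c \notin unsep C.
    by rewrite -eqR; apply: contraL cC'in; apply: unsep_notin.
  have Dc e : e \notin C' :\ c -> e \notin C' \/ e = c.
    by rewrite in_setD1 negb_and negbK => /orP[/eqP->|]; [right|left].
  apply: unsep_min => [j e te /Dc[eC|ec]|d e dR hd /Dc[eC|ec]].
  - exact: unsep_source te eC.
  - by case/negP: ncR; apply: (unsep_source (i := j)); rewrite -?ec // ec.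
  - exact: unsep_succ dR hd eC.
  - by case/negP: ncR; apply: (unsep_succ (d := d)); rewrite -?eqR // -?ec // ec.
have nD : nearest r W (C' :\ c).
  rewrite /nearest /covers (leq_trans (subset_leq_card (subD1set _ _))) ?cC' //.
  rewrite (disjointWr subD) ?eqR //; apply/forall_inP => X /(implyP (minC X)).
  by apply: leq_trans; rewrite -eqR subset_leq_card.
have := nearest_card cut nD; rewrite -{1}cC' (cardsD1 c C') cC'in => /esym/eqP.
by rewrite -[X in _ == X]add0n eqn_add2r.
Qed.

Theorem Wstar_covers r W i : (r <= mincut tail head (sigma i) rho)%N ->
    (#|W| <= r)%N ->
  exists2 C, C \in Wstar tail head sigma r & [disjoint W & unsep C].
Proof.
move=> cut /nearest_exists[C nC]; exists C.
  by rewrite inE (nearest_card cut nC) (nearest_widehat cut nC) !eqxx.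
by have /andP[/andP[]] := nC.
Qed.

End SeparatingSets.

(** * Zero mutual information by counting keys *)

Section Independence.
Local Open Scope ring_scope.
Variables (M K A : finType).

Lemma card_pairs (P : pred (M * K)) :
  #|[set w | P w]| = (\sum_m #|[set k | P (m, k)]|)%N.
Proof.
under eq_bigr do rewrite -sum1dep_card.
by rewrite pair_big_dep -sum1dep_card; apply: eq_bigl => -[m k].
Qed.

Lemma mutinfo_eq0 (Y : M * K -> A) (m0 : M) :
    (forall m a, #|[set k | Y (m, k) == a]| = #|[set k | Y (m0, k) == a]|) ->
  mutinfo Y (fun w => w.1) = 0.
Proof.
move=> unif; rewrite /mutinfo big1 // => a _; rewrite big1 // => b _ /=.
case: ifPn => // nz.
set pab := prob _ in nz *; set pa := prob _; set pb := prob _.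
suff eqp : pab = pa * pb by rewrite -eqp divff // Rpower.ln_1 mulr0.
pose c := #|[set k | Y (m0, k) == a]|.
have cab : #|[set w : M * K | (Y w == a) && (w.1 == b)]| = c.
  rewrite card_pairs (bigD1 b) //= big1 ?addn0 => [|m nm].
    rewrite /c -(unif b); apply: eq_card => k.
    by rewrite !inE eqxx andbT.
  by apply/eqP; rewrite cards_eq0; apply/eqP/setP => k; rewrite !inE (negPf nm) andbF.
have ca : #|[set w : M * K | Y w == a]| = (#|M| * c)%N.
  by rewrite card_pairs (eq_bigr (fun=> c)) ?sum_nat_const // => m _; apply: unif.
have cb : #|[set w : M * K | w.1 == b]| = #|K|.
  rewrite card_pairs (bigD1 b) //= big1 ?addn0 => [|m nm].
    by apply: eq_card => k; rewrite !inE eqxx.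
  by apply/eqP; rewrite cards_eq0; apply/eqP/setP => k; rewrite !inE (negPf nm).
(* A nonzero joint probability forces a nonempty sample space, whose size can then be cancelled. *)
have cO : #|{: M * K}|%:R != 0 :> Rdefinitions.R.
  by apply: contraNneq nz => O0; rewrite /pab /prob O0 invr0 mulr0.
rewrite /pab /pa /pb /prob cab ca cb mulf_div -natrM mulnAC -card_prod.
by rewrite mulnC natrM -mulf_div divff // mulr1.
Qed.

End Independence.

(** * Linear flows and network codes *)

Section Coding.
Local Open Scope ring_scope.
Variables (V E : finType) (tail head : E -> V) (s : nat).
Variables (sigma : 'I_s -> V) (rho : V) (F : finFieldType).
Hypothesis wf : wf_network tail head sigma rho.

Lemma src_index_sigma i : src_index sigma (sigma i) = Some i.
Proof.
rewrite /src_index; case: wf => _ inj _ _ _.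
by case: pickP => [j /eqP/inj->//|/(_ i)]; rewrite eqxx.
Qed.

Lemma src_index_some u i : src_index sigma u = Some i -> sigma i = u.
Proof. by rewrite /src_index; case: pickP => // j /eqP + [<-]. Qed.

Lemma src_index_head d : src_index sigma (head d) = None.
Proof.
case: wf => _ _ srcE _ _; rewrite /src_index; case: pickP => // i /eqP si.
have : is_source sigma (head d) by apply/existsP; exists i; rewrite si.
by rewrite srcE => /existsP[]; exists d.
Qed.

Section Flow.
Variables (p : nat) (y : E -> 'M[F]_(p, 1)) (a : E -> E -> 'M[F]_1).
Hypothesis flow : forall e, src_index sigma (tail e) = None ->
  y e = \sum_(d | head d == tail e) y d *m a d e.

Lemma flow_conservation n (v : E -> 'rV[F]_n) :
    (forall d, head d != rho -> v d = \sum_(e | tail e == head d) a d e *m v e) ->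
  \sum_(e | head e == rho) y e *m v e =
  \sum_i \sum_(e | tail e == sigma i) y e *m v e.
Proof.
move=> vE.
rewrite (exchange_big_dep (fun e => src_index sigma (tail e))) //=; last first.
  by move=> i e _ /eqP->; rewrite src_index_sigma.
under [RHS]eq_bigr => e se.
  have [i si] : exists i, src_index sigma (tail e) = Some i.
    by case: (src_index sigma (tail e)) se => // i _; exists i.
  rewrite (big_pred1 i) => [|j]; first over.
  rewrite -(src_index_some si) eq_sym; case: wf => _ inj _ _ _; exact: inj_eq.
(* With the relay edges added, both sides become the sum over all edges: what leaves the relays
   equals what enters nodes other than [rho]. *)
apply: (@addIr _ (\sum_(e | ~~ src_index sigma (tail e)) y e *m v e)).
transitivity (\sum_e y e *m v e); last first.
  by rewrite (bigID (fun e => src_index sigma (tail e))).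
rewrite [RHS](bigID (fun e => head e == rho)) /=; congr (_ + _).
transitivity (\sum_(e | ~~ src_index sigma (tail e))
    \sum_(d | head d == tail e) y d *m a d e *m v e).
  by apply: eq_bigr => e; case si: src_index => // _; rewrite flow // mulmx_suml.
rewrite (exchange_big_dep (fun d => head d != rho)) /=; last first.
  by move=> e d _ /eqP->; case: wf => _ _ _ _ [].
apply: eq_bigr => d nrho; rewrite (vE d nrho) mulmx_sumr.
apply: eq_big => [e|e _]; last by rewrite mulmxA.
rewrite [RHS]eq_sym; case: eqP => [<-|]; last by rewrite andbF.
by rewrite src_index_head.
Qed.

(** An edge outside both [C] and [unsep C] leaves no source, and all its predecessors lie outside
    [unsep C]; induct on depth. *)
Lemma flow_unsep_eq0 (C : {set E}) :
    {in C, forall e, y e = 0} -> {in ~: unsep tail head sigma C, forall e, y e = 0}.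
Proof.
move=> y0 e; rewrite in_setC; have [k] := ubnP (depth tail head e).
elim: k e => // k IH e; rewrite ltnS => dep nR.
have [/y0//|eC] := boolP (e \in C).
case si: (src_index sigma (tail e)) => [i|].
  by case/negP: nR; exact: unsep_source (esym (src_index_some si)) eC.
rewrite flow // big1 // => d /eqP hd; rewrite IH ?mul0mx //.
  by apply: leq_trans dep; apply: depth_ltn => //; case: wf.
by apply: contra nR => dR; apply: unsep_succ dR hd eC.
Qed.

End Flow.

Lemma code_eqs_inj l n (C : lsn_code E s F l n) m k y y' :
  code_eqs tail head sigma m k y -> code_eqs (C := C) tail head sigma m k y' -> y = y'.
Proof.
move=> /forallP ye /forallP ye'; apply/ffunP => e.
have [j] := ubnP (depth tail head e); elim: j e => // j IH e; rewrite ltnS => dep.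
rewrite (eqP (ye e)) (eqP (ye' e)); case: src_index => // .
apply: eq_bigr => d /eqP hd; rewrite IH //.
by apply: leq_trans dep; apply: depth_ltn => //; case: wf.
Qed.

Lemma msgs_unique l n (C : lsn_code E s F l n) m k y :
  code_eqs (C := C) tail head sigma m k y -> msgs tail head sigma m k = y.
Proof.
move=> yE; rewrite /msgs; case: pickP => [y' y'E|/(_ y)]; last by rewrite yE.
exact: code_eqs_inj y'E yE.
Qed.

(** The column [g i e] turns the vector injected by source [i] into its contribution to the symbol
    on [e]. *)
Lemma source_kernels n (P : 'I_s -> E -> 'cV[F]_n) (a : E -> E -> 'M[F]_1) :
  exists g : 'I_s -> E -> 'cV[F]_n, forall i e,
    g i e = match src_index sigma (tail e) with
            | Some j => if j == i then P i e else 0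
            | None => \sum_(d | head d == tail e) g i d *m a d e
            end.
Proof.
suff /fin_all_exists[g gE] : forall i, exists f : E -> 'cV[F]_n, forall e,
    f e = match src_index sigma (tail e) with
          | Some j => if j == i then P i e else 0
          | None => \sum_(d | head d == tail e) f d *m a d e
          end by exists g.
move=> i; case: wf => acyc _ _ _ _.
have [|f fE] := topological_recursion 0 (step := fun e (f : E -> 'cV[F]_n) =>
    match src_index sigma (tail e) with
    | Some j => if j == i then P i e else 0
    | None => \sum_(d | head d == tail e) f d *m a d e
    end) acyc; last by exists f.
move=> e f f' eqf; case: src_index => //.
by apply: eq_bigr => d /eqP/eqf->.
Qed.


(** * The masked code: decoding and secrecy *)

Section SecureCode.
Variables (l r : nat) (v : E -> 'rV[F]_(r + l)) (a : E -> E -> 'M[F]_1).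
Variables (P g : 'I_s -> E -> 'cV[F]_(r + l)).
Variables (Bm : 'M[F]_(l, r + l)) (Bk : 'M[F]_(r, r + l)) (D : 'M[F]_(r + l, l)).
Hypothesis gE : forall i e,
  g i e = match src_index sigma (tail e) with
          | Some j => if j == i then P i e else 0
          | None => \sum_(d | head d == tail e) g i d *m a d e
          end.

Definition masked_code : lsn_code E s F l 1 :=
  LSNCode (keylen := fun=> r) (fun i e => col_mx Bm Bk *m P i e) a
    (fun f => (\sum_(e | head e == rho) f e *m v e) *m D).

Implicit Types (m : msg_space s F l) (k : key_space masked_code).

Definition injected m k i : 'rV[F]_(r + l) := m i *m Bm + k i *m Bk.

Definition edge_msgs m k : {ffun E -> 'rV[F]_1} :=
  [ffun e => \sum_i injected m k i *m g i e].

Lemma edge_msgs_source m k i e :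
  tail e = sigma i -> edge_msgs m k e = injected m k i *m P i e.
Proof.
move=> te; rewrite ffunE (bigD1 i) //= big1 => [|j ji].
  by rewrite gE te src_index_sigma eqxx addr0.
by rewrite gE te src_index_sigma eq_sym (negPf ji) mulmx0.
Qed.

Lemma edge_msgs_relay m k e : src_index sigma (tail e) = None ->
  edge_msgs m k e = \sum_(d | head d == tail e) edge_msgs m k d *m a d e.
Proof.
move=> si; rewrite ffunE.
under eq_bigr do rewrite gE si mulmx_sumr.
rewrite exchange_big; apply: eq_bigr => d _; rewrite ffunE mulmx_suml.
by apply: eq_bigr => i _; rewrite mulmxA.
Qed.

Lemma msgs_masked_code m k : msgs tail head sigma m k = edge_msgs m k.
Proof.
apply: msgs_unique; apply/forallP => e; apply/eqP.
case si: (src_index sigma (tail e)) => [i|]; last exact: edge_msgs_relay.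
by rewrite (edge_msgs_source _ _ (esym (src_index_some si))) mulmxA mul_row_col.
Qed.

Lemma masked_code_decodes :
    (forall d, head d != rho -> v d = \sum_(e | tail e == head d) a d e *m v e) ->
    (forall i, \sum_(e | tail e == sigma i) P i e *m v e = 1%:M) ->
    Bm *m D = 1%:M -> Bk *m D = 0 ->
  forall m k, dec masked_code
      (restrict [set e | head e == rho] (msgs tail head sigma m k)) =
    \sum_i m i.
Proof.
move=> vE Pv BmD BkD m k; rewrite msgs_masked_code /=.
transitivity ((\sum_(e | head e == rho) edge_msgs m k e *m v e) *m D).
  by congr (_ *m _); apply: eq_bigr => e he; rewrite ffunE inE he.
rewrite (flow_conservation (@edge_msgs_relay m k) vE) mulmx_suml.
apply: eq_bigr => i _.
under eq_bigr => e /eqP te do rewrite (edge_msgs_source m k te) -mulmxA.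
by rewrite -mulmx_sumr Pv mulmx1 mulmxDl -!mulmxA BmD BkD mulmx1 mulmx0 addr0.
Qed.

(* Adding a key that hides [m] translates the keys consistent with [m] and a
   given observation onto those consistent with the zero message. *)
Lemma masked_code_secure (W : {set E}) :
    (forall m, exists k, {in W, forall e, edge_msgs m k e = 0}) ->
  mutinfo (YW tail head sigma (C := masked_code) W) (MS (C := masked_code)) = 0.
Proof.
move=> hide; apply: (mutinfo_eq0 (m0 := [ffun=> 0])) => m y.
have [k0 k0E] := hide m.
pose shift k : key_space masked_code := [ffun i => (k i + k0 i : 'rV_r)].
have shift_inj : injective shift.
  move=> k k' /ffunP eqk; apply/ffunP => i.
  by have := eqk i; rewrite !ffunE => /addIr.
rewrite -(card_preimset _ shift_inj); apply: eq_card => k; rewrite !inE; congr (_ == _).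
apply/ffunP => e; rewrite /YW !ffunE !msgs_masked_code; case: ifP => // eW.
have := k0E e eW; rewrite !ffunE => k0e.
rewrite -[RHS]addr0 -[X in _ = _ + X]k0e -big_split /=.
apply: eq_bigr => i _; rewrite -mulmxDl; congr (_ *m _).
by rewrite /injected !ffunE mul0mx add0r mulmxDl addrCA.
Qed.

(** Each source cancels its own contribution on [C]; the total flow then vanishes on [C], hence on
    everything [C] separates. *)
Lemma masked_code_hides (C W : {set E}) (m : msg_space s F l) :
    (forall i, exists ki : 'rV[F]_r,
       {in C, forall e, (m i *m Bm + ki *m Bk) *m g i e = 0}) ->
    [disjoint W & unsep tail head sigma C] ->
  exists k, {in W, forall e, edge_msgs m k e = 0}.
Proof.
move=> /fin_all_exists[k kE] dis.
pose k' : key_space masked_code := [ffun i => (k i : 'rV_r)].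
exists k' => e eW; apply: (flow_unsep_eq0 (@edge_msgs_relay m k') (C := C)).
  by move=> d dC; rewrite ffunE big1 // => i _; rewrite /injected ffunE kE.
by rewrite in_setC (disjointFr dis eW).
Qed.

End SecureCode.

(** * Assembling the secure code *)

Lemma source_exists : exists i : 'I_s, True.
Proof.
case: wf => acyc _ srcE nsrho _.
move: nsrho; rewrite srcE negbK => /existsP[e0 _].
case: (arg_minnP (depth tail head) (isT : xpredT e0)) => e _ emin.
have : is_source sigma (tail e).
  rewrite srcE; apply/existsP => -[d /eqP /(depth_ltn acyc)].
  by rewrite ltnNge emin.
by case/existsP => i _; exists i.
Qed.

Lemma sub_sum_rowsP (I : finType) (Q : pred I) p n (A : 'M[F]_(p, n))
    (w : I -> 'rV[F]_n) :
    (A <= \sum_(i | Q i) <<w i>>)%MS ->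
  exists u : I -> 'cV[F]_p, A = \sum_(i | Q i) u i *m w i.
Proof.
case/sub_sumsmxP => u ->; exists (fun i => u i *m <<w i>>%MS *m pinvmx (w i)).
by apply: eq_bigr => i _; rewrite mulmxKpV // (submx_trans (submxMl _ _)) // genmxE.
Qed.

Lemma secure_code_exists l r :
    (r + l <= Cmin tail head sigma rho)%N ->
    (s * #|Wstar tail head sigma r| < #|F|)%N ->
  exists C : lsn_code E s F l 1, admissible tail head sigma rho C r.
Proof.
move=> nC ltq; have [acyc _ _ _ [nrho _]] := wf; have [i0 _] := source_exists.
have cut i : (r + l <= mincut tail head (sigma i) rho)%N.
  exact: leq_trans nC (Cmin_leq _ _ _ _ _).
have cutr := leq_trans (leq_addr l r) (cut i0).
have ltsq : (s < #|F|)%N.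
  (* [Wstar] is nonempty because some member covers the empty set, so the field bound also gives
     [s < #|F|]. *)
  apply: leq_ltn_trans ltq; rewrite leq_pmulr // card_gt0.
  have [|C WC _] := Wstar_covers (W := set0) cutr; first by rewrite cards0.
  by apply/set0Pn; exists C.
have [v [vS v1]] := backward_vectors acyc nrho ltsq cut.
have /fin_all_exists[P Pv] i := sub_sum_rowsP (v1 i).
have /fin_all_exists[a va] : forall d, exists ad : E -> 'M[F]_1,
    head d != rho -> v d = \sum_(e | tail e == head d) ad e *m v e.
  move=> d; have [rd|nd] := eqVneq (head d) rho; first by exists (fun=> 0).
  have := vS d; rewrite /succ_span (negPf nd) => /sub_sum_rowsP[u uE].
  by exists u.
have [g gE] := source_kernels P a.
(* The left kernel of [G i W] consists of the injected vectors of source [i] invisible on [W]; its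
   codimension is at most [#|W|]. *)
pose G i (W : {set E}) := \matrix_(x < r + l, b < #|W|) g i (enum_val b) x 0.
have [|N|K KG] := @common_supplement F (r + l) r
    [seq kermx (G i W) | i <- enum 'I_s, W <- enum (Wstar tail head sigma r)].
- by rewrite size_allpairs size_enum_ord -cardE.
- case/allpairsP => -[i W] /= [_ + ->]; rewrite mem_enum inE => /andP[/eqP Wr _].
  rewrite mxrank_ker -[leqLHS](subnK (rank_leq_row (G i W))) leq_add2l.
  by rewrite -[X in (_ <= X)%N]Wr rank_leq_col.
have [Bm [Bk [D [KBk BmD BkD]]]] := complete_rows K.
exists (masked_code v a P Bm Bk D); split.
  exact: masked_code_decodes.
move=> W leW; apply: (masked_code_secure gE) => m.
have [C WC dis] := Wstar_covers cutr leW.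
apply: masked_code_hides dis => // i.
have /KG full : kermx (G i C) \in
    [seq kermx (G i W) | i <- enum 'I_s, W <- enum (Wstar tail head sigma r)].
  by apply: allpairs_f; rewrite mem_enum.
(* The message part is an invisible vector plus a combination [z' *m Bk] of key rows; the key [- z']
   cancels the latter. *)
have /sub_addsmxP[[x z] /= mE] := submx_trans (submx1 (m i *m Bm)) full.
have /submxP[z' zE] := submx_trans (submxMl z K) KBk.
exists (- z') => e eC.
have -> : m i *m Bm + - z' *m Bk = x *m kermx (G i C).
  by rewrite mE zE mulNmx addrK.
have /matrixP ker0 := mulmx_ker (G i C).
have kg0 : kermx (G i C) *m g i e = 0.
  apply/matrixP => p q; rewrite [q]ord1 [RHS]mxE.
  have := ker0 p (enum_rank_in eC e); rewrite [RHS]mxE => <-.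
  by rewrite !mxE; apply: eq_bigr => j _; rewrite !mxE enum_rankK_in.
by rewrite -mulmxA kg0 mulmx0.
Qed.

End Coding.

Theorem mainTheorem14
  (V E : finType) (tail head : E -> V) (s : nat) (sigma : 'I_s -> V) (rho : V)
  (F : finFieldType) (r : nat) :
  wf_network tail head sigma rho ->
  r <= Cmin tail head sigma rho ->
  forall R : nat, r <= R <= Cmin tail head sigma rho ->
  s * #|Wstar tail head sigma r| < #|F| ->
  exists C : lsn_code E s F (R - r) 1, admissible tail head sigma rho C r.
Proof.
move=> wf _ R /andP[leR leC] ltq.
by apply: (secure_code_exists wf); rewrite ?subnKC.
Qed.
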